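(* Let $(X,d)$ be a metric space, let $k\ge 1$ and $p_1,p_2,\ldots,p_k\in X$, and let $D=X\setminus\{p_1,p_2,\ldots,p_k\}$. Then for all $x,y\in D$, $$\hat{\tau}_D(x,y)\le u_D(x,y).$$ Moreover, the inequality is sharp for $D=\mathbb{R}^n\setminus\{-e_1,e_1\}$ (that is, $X=\mathbb{R}^n$ with the Euclidean metric, $n\ge 2$, $k=2$, $\{p_1,p_2\}=\{-e_1,e_1\}$, $e_1=(1,0,\ldots,0)$): there is no constant $c<1$ such that $\hat{\tau}_D(x,y)\le c\,u_D(x,y)$ for all $x,y\in D$.
   Context: For a metric space $(X,d)$, points $p_1,\ldots,p_k\in X$ and $D=X\setminus\{p_1,\ldots,p_k\}$, write $d(x)=\min_{1\le i\le k}d(x,p_i)$ for $x\in D$ (the distance from $x$ to the boundary of $D$). The average scale-invariant Cassinian metric of $D$ is $$\hat{\tau}_D(x,y)=\frac1k\sum_{i=1}^k\log\left(1+2\frac{d(x,y)}{\sqrt{d(x,p_i)\,d(y,p_i)}}\right),\quad x,y\in D.$$ Ibragimov's metric on $D$ is $$u_D(x,y)=2\log\frac{d(x,y)+\max\{d(x),d(y)\}}{\sqrt{d(x)\,d(y)}},\quad x,y\in D.$$ *)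

(* Defs.v *)
From HB Require Import structures.
From mathcomp Require Import all_boot all_order all_algebra.
From mathcomp Require Import ring lra.
From mathcomp Require Import all_classical all_reals all_analysis.

Set Implicit Arguments.
Unset Strict Implicit.
Unset Printing Implicit Defensive.

Import Order.TTheory GRing.Theory Num.Theory.

Local Open Scope classical_set_scope.
Local Open Scope ring_scope.

Section PuncturedMetricSpace.
Context {R : realType} {X : metricType R} {k : nat}.

(* A family of at least one puncture is indexed by 'I_k.+1, so that the average
   and the minimum over it make sense; the points may repeat. *)
Variable p : 'I_k.+1 -> X.

Definition punctured : set X := ~` range p.

(* The default value of the iterated minimum is itself one of the distances. *)
Definition boundary_dist (x : X) : R :=
  \big[Num.min/mdist x (p ord0)]_(i < k.+1) mdist x (p i).

Definition avg_cassinian (x y : X) : R :=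
  k.+1%:R^-1 * \sum_(i < k.+1)
    ln (1 + 2 * (mdist x y / Num.sqrt (mdist x (p i) * mdist y (p i)))).

Definition ibragimov (x y : X) : R :=
  2 * ln ((mdist x y + Num.max (boundary_dist x) (boundary_dist y)) /
          Num.sqrt (boundary_dist x * boundary_dist y)).

End PuncturedMetricSpace.

(* The library equips 'rV[R]_n with the sup norm, hence an alias carrying the
   Euclidean metric. *)
Definition euclidean (R : realType) (n : nat) : Type := 'rV[R]_n.

HB.instance Definition _ (R : realType) (n : nat) :=
  GRing.Zmodule.copy (euclidean R n) 'rV[R]_n.

Section EuclideanMetric.
Context {R : realType} {n : nat}.
Implicit Types x y z : euclidean R n.

Definition euclidean_dist x y : R :=
  Num.sqrt (\sum_(i < n) (x 0 i - y 0 i) ^+ 2).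

Let sum_sqr_ge0 (a : 'I_n -> R) : 0 <= \sum_i a i ^+ 2.
Proof. by apply: sumr_ge0 => i _; exact: sqr_ge0. Qed.

Lemma cauchy_schwarz_sum (a b : 'I_n -> R) :
  (\sum_i a i * b i) ^+ 2 <= (\sum_i a i ^+ 2) * (\sum_i b i ^+ 2).
Proof.
have E (c d : 'I_n -> R) :
    (\sum_i c i) * (\sum_i d i) = \sum_i \sum_j c i * d j.
  by rewrite mulr_suml; apply: eq_bigr => i _; rewrite mulr_sumr.
have H : 0 <= \sum_i \sum_j (a i * b j - a j * b i) ^+ 2.
  by apply: sumr_ge0 => i _; apply: sumr_ge0 => j _; exact: sqr_ge0.
suff : \sum_i \sum_j (a i * b j - a j * b i) ^+ 2 =
       ((\sum_i a i ^+ 2) * (\sum_i b i ^+ 2)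
        - (\sum_i a i * b i) ^+ 2) * 2.
  by move=> eqH; rewrite -subr_ge0; move: H; rewrite eqH pmulr_lge0.
have -> : ((\sum_i a i ^+ 2) * (\sum_i b i ^+ 2)
        - (\sum_i a i * b i) ^+ 2) * 2 =
  (\sum_i a i ^+ 2) * (\sum_i b i ^+ 2) + (\sum_i b i ^+ 2) * (\sum_i a i ^+ 2)
  - 2 * ((\sum_i a i * b i) * (\sum_i a i * b i)) by ring.
rewrite !E mulr_sumr -big_split -sumrB; apply: eq_bigr => i _ /=.
rewrite mulr_sumr -big_split -sumrB; apply: eq_bigr => j _ /=; ring.
Qed.

Lemma euclidean_distxx x : euclidean_dist x x = 0.
Proof.
rewrite /euclidean_dist big1 ?sqrtr0// => i _.
by rewrite subrr expr0n.
Qed.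

Lemma euclidean_dist_positivity x y : euclidean_dist x y = 0 -> x = y.
Proof.
move=> /eqP; rewrite sqrtr_eq0 => le0.
have /eqP : \sum_(i < n) (x 0 i - y 0 i) ^+ 2 = 0.
  by apply/eqP; rewrite eq_le le0 sum_sqr_ge0.
rewrite psumr_eq0; last by move=> i _; exact: sqr_ge0.
move=> /allP H; apply/rowP => i; apply/eqP; rewrite -subr_eq0 -sqrf_eq0.
by apply: H; rewrite mem_index_enum.
Qed.

Lemma euclidean_dist_sym x y : euclidean_dist x y = euclidean_dist y x.
Proof.
by congr Num.sqrt; apply: eq_bigr => i _; rewrite -sqrrN opprB.
Qed.

Lemma euclidean_dist_triangle y x z :
  euclidean_dist x z <= euclidean_dist x y + euclidean_dist y z.
Proof.
have d0 u v : 0 <= euclidean_dist u v by exact: sqrtr_ge0.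
rewrite -(ler_pXn2r (_ : 0 < 2)%N) ?nnegrE ?addr_ge0//.
rewrite sqrrD ![euclidean_dist _ _ ^+ 2]sqr_sqrtr//.
pose a i := x 0 i - y 0 i; pose b i := y 0 i - z 0 i.
have -> : \sum_i (x 0 i - z 0 i) ^+ 2 =
    \sum_i a i ^+ 2 + (\sum_i a i * b i) *+ 2 + \sum_i b i ^+ 2.
  rewrite -sumrMnl -!big_split; apply: eq_bigr => i _ /=.
  by rewrite -sqrrD /a /b addrA subrK.
rewrite lerD2r lerD2l lerMn2r /= /euclidean_dist -sqrtrM//.
apply: le_trans (ler_norm _) _; rewrite -sqrtr_sqr.
by apply: ler_wsqrtr; exact: cauchy_schwarz_sum.
Qed.

End EuclideanMetric.

HB.instance Definition _ (R : realType) (n : nat) :=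
  isMetric.Build R (euclidean R n) euclidean_distxx euclidean_dist_positivity
    euclidean_dist_sym euclidean_dist_triangle.

Definition e1 (R : realType) (n : nat) : euclidean R n :=
  \row_(j < n) (j == 0 :> nat)%:R.

Definition pm_e1 (R : realType) (n : nat) (i : 'I_2) : euclidean R n :=
  if i == ord0 then - e1 R n else e1 R n.

(* Main.v *)
Require Import Defs.
From mathcomp Require Import all_boot all_order all_algebra.
From mathcomp Require Import ring lra.
From mathcomp Require Import all_classical all_reals all_analysis.

Import Order.TTheory GRing.Theory Num.Theory.

Local Open Scope classical_set_scope.
Local Open Scope ring_scope.

(** For the upper bound, [d(x,p_i) >= d(x)] and [d(y,p_i) >= d(y)] bound every
    summand by its value at [d(x)] and [d(y)]; with [t = d(x,y)] and
    [M = max(d(x),d(y)) >= sqrt (d(x) d(y))] it then suffices that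
    [d(x) d(y) + 2 t sqrt (d(x) d(y)) <= (t + M)^2].

    For sharpness, take [x] and [y = -x] on the axis of [e_2], at equal distance
    [a] from both punctures.  With [r = d(x,y) / a] the two sides are
    [ln (1 + 2 r)] and [2 ln (1 + r)], whose ratio tends to 1 as [r -> 0]. *)

Lemma le_ln (R : realType) (a b : R) : 0 < a -> a <= b -> ln a <= ln b.
Proof. by move=> a0 ab; rewrite ler_ln ?posrE//; exact: lt_le_trans ab. Qed.

(** This is [ln (1 + v) <= v] at [v = - (u / (1 + u))], where [1 + v] is the inverse of [1 + u]. *)
Lemma ln1D_ge (R : realType) (u : R) : 0 <= u -> u / (1 + u) <= ln (1 + u).
Proof.
move=> u0; have u1 : 0 < 1 + u by lra.
have inv : 1 + - (u / (1 + u)) = (1 + u)^-1.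
  by field; rewrite gt_eqF.
have gtN1 : -1 < - (u / (1 + u)).
  by rewrite -subr_gt0 opprK addrC inv invr_gt0.
by have := le_ln1Dx gtN1; rewrite inv lnV ?posrE// lerN2.
Qed.

(** Here [a], [b] stand for the boundary distances of the two points, and [a'], [b'] for their
    distances to one puncture. *)
Lemma cassinian_term_le (R : realType) (t a b a' b' : R) :
  0 <= t -> 0 < a -> 0 < b -> a <= a' -> b <= b' ->
  ln (1 + 2 * (t / Num.sqrt (a' * b'))) <=
  2 * ln ((t + Num.max a b) / Num.sqrt (a * b)).
Proof.
move=> t0 a0 b0 aa bb.
have ab0 : 0 < a * b by rewrite mulr_gt0.
have ab'0 : 0 < a' * b'.
  by rewrite mulr_gt0 ?(lt_le_trans a0 aa) ?(lt_le_trans b0 bb).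
set q := Num.sqrt (a * b); set q' := Num.sqrt (a' * b').
have q0 : 0 < q by rewrite sqrtr_gt0.
have q'0 : 0 < q' by rewrite sqrtr_gt0.
have qq' : q <= q' by apply/ler_wsqrtr/ler_pM => //; exact: ltW.
set M := Num.max a b.
have M0 : 0 < M by rewrite lt_max a0.
have qM : q <= M.
  rewrite -(gtr0_norm M0) -sqrtr_sqr expr2; apply: ler_wsqrtr.
  by apply: ler_pM; rewrite ?(ltW a0) ?(ltW b0)// le_max lexx ?orbT.
have tM0 : 0 < (t + M) / q by rewrite divr_gt0// ltr_wpDl.
rewrite [leRHS]mulr_natl -lnXn//; apply: le_ln.
  by rewrite ltr_pwDl// mulr_ge0// divr_ge0// ltW.
apply: (@le_trans _ _ (1 + 2 * (t / q))).
  by rewrite lerD2l ler_pM2l// ler_wpM2l// lef_pV2 ?posrE.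
have -> : 1 + 2 * (t / q) = (q ^+ 2 + 2 * t * q) / q ^+ 2.
  by field; rewrite gt_eqF.
(* The gap [(t + M)^2 - q^2 - 2 t q] equals [t^2 + 2 t (M - q) + (M^2 - q^2)], nonnegative since
   [q <= M]. *)
rewrite expr_div_n ler_pM2r ?invr_gt0 ?exprn_gt0//; nra.
Qed.

Section BoundaryDistance.
Context {R : realType} {X : metricType R} {k : nat}.
Implicit Types (p : 'I_k.+1 -> X) (x y : X).

Lemma boundary_dist_le p x i : boundary_dist p x <= mdist x (p i).
Proof. exact: bigmin_le. Qed.

Lemma mdist_puncture_gt0 p x i : punctured p x -> 0 < mdist x (p i).
Proof.
by move=> px; rewrite mdist_gt0; apply/eqP => xE; apply: px; exists i.
Qed.

Lemma boundary_dist_gt0 p x : punctured p x -> 0 < boundary_dist p x.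
Proof.
by move=> px; apply: lt_bigmin => [|i _]; exact: mdist_puncture_gt0.
Qed.

Lemma avg_cassinian_le_ibragimov p x y :
  punctured p x -> punctured p y -> avg_cassinian p x y <= ibragimov p x y.
Proof.
move=> px py; rewrite ler_pdivrMl ?ltr0Sn// mulr_natl.
(* The right side becomes a constant sum over the punctures, to be compared term by term. *)
rewrite -[k.+1 in leRHS]card_ord -sumr_const; apply: ler_sum => i _.
by apply: cassinian_term_le;
  rewrite ?mdist_ge0 ?boundary_dist_gt0 ?boundary_dist_le.
Qed.

Lemma boundary_dist_equidistant p x a :
  (forall i, mdist x (p i) = a) -> boundary_dist p x = a.
Proof.
move=> xa; apply/le_anti; rewrite -{1}(xa ord0) boundary_dist_le.
by apply: le_bigmin => [|i _]; rewrite xa.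
Qed.

Lemma avg_cassinian_equidistant p x y a : 0 < a ->
  (forall i, mdist x (p i) = a) -> (forall i, mdist y (p i) = a) ->
  avg_cassinian p x y = ln (1 + 2 * (mdist x y / a)).
Proof.
move=> a0 xa ya; rewrite /avg_cassinian.
under eq_bigr do rewrite xa ya -expr2 sqrtr_sqr gtr0_norm//.
by rewrite sumr_const card_ord -[X in _ * X]mulr_natl mulKf// pnatr_eq0.
Qed.

Lemma ibragimov_equidistant p x y a : 0 < a ->
  (forall i, mdist x (p i) = a) -> (forall i, mdist y (p i) = a) ->
  ibragimov p x y = 2 * ln (1 + mdist x y / a).
Proof.
move=> a0 xa ya; rewrite /ibragimov.
rewrite (boundary_dist_equidistant _ _ _ xa).
rewrite (boundary_dist_equidistant _ _ _ ya).
by rewrite maxxx -expr2 sqrtr_sqr gtr0_norm//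
   [in ln _]mulrDl divff ?gt_eqF// [in RHS]addrC.
Qed.

End BoundaryDistance.

(** Indices start at 0, so index 1 is the direction of e_2, orthogonal to the line through the
    punctures. *)
Definition axis2 (R : realType) (n : nat) (s : R) : euclidean R n :=
  \row_(j < n) (s * (j == 1 :> nat)%:R).

Lemma mdist_axis2_pm_e1 (R : realType) (m : nat) (s : R) (i : 'I_2) :
  mdist (axis2 R m.+2 s) (pm_e1 R m.+2 i) = Num.sqrt (1 + s ^+ 2).
Proof.
congr Num.sqrt; rewrite 2!big_ord_recl big1 => [|j _].
  by rewrite /pm_e1; case: ifP => _; rewrite !mxE /=; ring.
by rewrite /pm_e1; case: ifP => _; rewrite !mxE /=; ring.
Qed.

Lemma mdist_axis2 (R : realType) (m : nat) (s t : R) :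
  mdist (axis2 R m.+2 s) (axis2 R m.+2 t) = `|s - t|.
Proof.
rewrite -sqrtr_sqr; congr Num.sqrt.
by rewrite 2!big_ord_recl big1 => [|j _]; rewrite !mxE /=; ring.
Qed.

Lemma punctured_axis2 (R : realType) (m : nat) (s : R) :
  punctured (pm_e1 R m.+2) (axis2 R m.+2 s).
Proof.
move=> [i _ pE].
have := mdist_axis2_pm_e1 R m s i; rewrite pE mdistxx => /esym/eqP.
by rewrite gt_eqF// sqrtr_gt0 ltr_pwDl// sqr_ge0.
Qed.

(** The bounds [2 r / (1 + 2 r) <= ln (1 + 2 r)] and [ln (1 + r) <= r] have matching first-order
    terms. The explicit error factor [1 + 4 * s] replaces a limit as s tends to 0. *)
Lemma cassinian_ratio_axis2 (R : realType) (m : nat) (c s : R) :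
  0 < s ->
  avg_cassinian (pm_e1 R m.+2) (axis2 R m.+2 s) (axis2 R m.+2 (- s)) <=
    c * ibragimov (pm_e1 R m.+2) (axis2 R m.+2 s) (axis2 R m.+2 (- s)) ->
  1 <= c * (1 + 4 * s).
Proof.
move=> s0; set a := Num.sqrt (1 + s ^+ 2).
have a1 : 1 <= a.
  by rewrite -[leLHS]sqrtr1; apply: ler_wsqrtr; rewrite lerDl sqr_ge0.
have a0 : 0 < a by lra.
have xa i : mdist (axis2 R m.+2 s) (pm_e1 R m.+2 i) = a.
  exact: mdist_axis2_pm_e1.
have ya i : mdist (axis2 R m.+2 (- s)) (pm_e1 R m.+2 i) = a.
  by rewrite mdist_axis2_pm_e1 sqrrN.
rewrite (avg_cassinian_equidistant _ _ _ _ a0 xa ya).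
rewrite (ibragimov_equidistant _ _ _ _ a0 xa ya).
rewrite mdist_axis2 opprK gtr0_norm ?addr_gt0//.
set r := (s + s) / a => le_c.
have r0 : 0 < r by rewrite divr_gt0// addr_gt0.
have r2s : r <= 2 * s by rewrite ler_pdivrMr//; nra.
have lo : 2 * r / (1 + 2 * r) <= ln (1 + 2 * r) by apply: ln1D_ge; lra.
have up : ln (1 + r) <= r by apply: le_ln1Dx; lra.
have L0 : 0 < ln (1 + r) by rewrite ln_gt0// ltrDl.
(* The sign of [c] lets upper bounds be multiplied by it; it follows because the left side of [le_c]
   is positive. *)
have c0 : 0 <= c.
  have : 0 < c * (2 * ln (1 + r)).
    by apply: lt_le_trans (le_trans lo le_c); rewrite divr_gt0//; lra.
  by rewrite pmulr_lgt0 ?mulr_gt0// => /ltW.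
have : 2 * r / (1 + 2 * r) <= c * (2 * r).
  by apply: le_trans lo (le_trans le_c _); rewrite ler_wpM2l// ler_pM2l.
rewrite ler_pdivrMr; last by lra.
(* Cancelling [2 * r] leaves [1 <= c * (1 + 2 * r)], and [r <= 2 * s]. *)
rewrite mulrAC -[leLHS]mul1r ler_pM2r; last by lra.
by move=> /le_trans; apply; rewrite ler_wpM2l//; lra.
Qed.

Theorem theorem3p2 (R : realType) :
  (forall (X : metricType R) (k : nat) (p : 'I_k.+1 -> X) (x y : X),
     punctured p x -> punctured p y ->
     avg_cassinian p x y <= ibragimov p x y)
  /\
  (forall n : nat, (2 <= n)%N ->
     ~ exists c : R, c < 1 /\
         forall x y : euclidean R n,
           punctured (pm_e1 R n) x -> punctured (pm_e1 R n) y ->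
           avg_cassinian (pm_e1 R n) x y <= c * ibragimov (pm_e1 R n) x y).
Proof.
split=> [X k p x y|]; first exact: avg_cassinian_le_ibragimov.
case=> [|[|m]]// _ [c [c1 le_c]].
have bound s := le_c _ _ (punctured_axis2 R m s) (punctured_axis2 R m (- s)).
have c_ge : 1 <= c * 5.
  by have := cassinian_ratio_axis2 R m c 1 ltr01 (bound 1); lra.
(* For this [s] the bound reads [1 <= c * (1 + (1 - c) / 2)], that is [(1 - c) * (2 - c) <= 0],
   which is false for [c < 1]. *)
have s0 : 0 < (1 - c) / 8 by lra.
have := cassinian_ratio_axis2 R m c _ s0 (bound _); nra.
Qed.
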